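(* Let $R$ be a unital ring, $(\Omega^1(R),d)$ a first order differential calculus on $R$, and $S\subset R$ a left Ore set. Suppose that $\{x\in\Omega^1(R)\,|\,\exists t\in S,\ xt=0\}=0$. Then the following are equivalent: (i) The $S^{-1}R$-$R$-bimodule structure on $S^{-1}\Omega^1(R):=S^{-1}R\otimes_R\Omega^1(R)$ extends to an (actually unique) $S^{-1}R$-$S^{-1}R$-bimodule structure which may carry a differential $d_S:S^{-1}R\to S^{-1}\Omega^1(R)$, making $(S^{-1}R,S^{-1}\Omega^1(R),d_S)$ a first order differential calculus, such that the pair of localization maps $(\iota_S,\iota_{S,\Omega^1(R)})$ is a morphism in $\mathfrak{Fodc}$ from $(R,\Omega^1(R),d)$ to $(S^{-1}R,S^{-1}\Omega^1(R),d_S)$. (ii) The differential Ore condition is satisfied: for all $t\in S$ and all $r\in R$ there exist $s\in S$ and $\omega\in\Omega^1(R)$ such that $s\,dr=\omega t$.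
   Context: A subset $S$ of a ring $R$ is multiplicative if $1\in S$ and $S$ is closed under products. A left Ore set (also called left denominator set) is a multiplicative subset $S$ such that (left Ore condition) for all $s\in S$, $r\in R$ there are $s'\in S$, $r'\in R$ with $r's=s'r$, and (left reversibility) for all $n_1,n_2\in R$, $s\in S$, if $n_1s=n_2s$ then there is $s'\in S$ with $s'n_1=s'n_2$. $S^{-1}R$ denotes the left Ore localization (ring of left fractions), $\iota_S:R\to S^{-1}R$ the localization map, and for a left $R$-module $M$, $S^{-1}M=S^{-1}R\otimes_R M$ with localization map $\iota_{S,M}:M\to S^{-1}M$, $m\mapsto 1\otimes m$. A first order differential calculus (FODC) on a ring $R$ is an $R$-$R$-bimodule $\Omega^1(R)$ with an additive map $d:R\to\Omega^1(R)$ satisfying the Leibniz identity $d(ab)=d(a)b+a\,d(b)$ for all $a,b\in R$, and such that $\Omega^1(R)$ is generated by the differentials $dr$, $r\in R$, as a left $R$-module. In the category $\mathfrak{Fodc}$, objects are triples $(R,\Omega^1(R),d)$ of a ring and a FODC on it; a morphism $(R,\Omega^1(R),d)\to(R',\Omega^1(R'),d')$ is a pair $(f,e)$ of a ring map $f:R\to R'$ and a map $e:\Omega^1(R)\to\Omega^1(R')$ of $R$-$R$-bimodules (with $R$ acting on $\Omega^1(R')$ through $f$) such that $e\circ d=d'\circ f$. *)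

(* Defs.v *)
From HB Require Import structures.
From mathcomp Require Import all_boot all_order all_algebra.
From mathcomp Require Import boolp classical_sets.

Set Implicit Arguments.
Unset Strict Implicit.
Unset Printing Implicit Defensive.

Import GRing.Theory.
Local Open Scope classical_set_scope.
Local Open Scope ring_scope.

(* Rings are unital, associative, possibly noncommutative and possibly zero
   (pzRingType): S may contain 0, in which case the localization is zero. *)

Record is_left_ore_set (R : pzRingType) (S : set R) : Prop := {
  ore_one : S 1;
  ore_mul : forall s t : R, S s -> S t -> S (s * t);
  ore_left : forall s r : R, S s ->
    exists s' r' : R, S s' /\ r' * s = s' * r;
  ore_reversible : forall n1 n2 s : R, S s -> n1 * s = n2 * s ->
    exists s' : R, S s' /\ s' * n1 = s' * n2 }.

(* iota : R -> Q exhibits Q as the ring of left fractions S^-1 R; this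
   determines (Q, iota) up to a unique isomorphism under R. *)
Record is_left_fraction_ring (R : pzRingType) (S : set R)
    (Q : pzRingType) (iota : {rmorphism R -> Q}) : Prop := {
  frac_inv : forall s : R, S s ->
    exists u : Q, u * iota s = 1 /\ iota s * u = 1;
  frac_form : forall q : Q, exists (s r : R) (u : Q),
    [/\ S s, u * iota s = 1, iota s * u = 1 & q = u * iota r];
  frac_ker : forall r : R, iota r = 0 <-> exists s : R, S s /\ s * r = 0 }.

(* A right module structure is an explicit map x, b |-> x b rather than a
   structure attached to the type, because several right actions on the same
   left module have to be compared. *)
Record is_right_action (B : pzRingType) (M : zmodType) (ract : M -> B -> M) :
    Prop := {
  ract_one : forall x : M, ract x 1 = x;
  ract_mul : forall (x : M) (a b : B), ract x (a * b) = ract (ract x a) b;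
  ract_addl : forall (x y : M) (b : B), ract (x + y) b = ract x b + ract y b;
  ract_addr : forall (x : M) (a b : B), ract x (a + b) = ract x a + ract x b }.

Record is_bimodule (A B : pzRingType) (M : lmodType A) (ract : M -> B -> M) :
    Prop := {
  bimod_right : is_right_action ract;
  bimod_comm : forall (a : A) (x : M) (b : B),
    ract (a *: x) b = a *: ract x b }.

Record is_balanced (R : pzRingType) (N : zmodType) (ract : N -> R -> N)
    (M : lmodType R) (B : zmodType) (f : N -> M -> B) : Prop := {
  bal_addl : forall (n n' : N) (m : M), f (n + n') m = f n m + f n' m;
  bal_addr : forall (n : N) (m m' : M), f n (m + m') = f n m + f n m';
  bal_mid : forall (n : N) (r : R) (m : M), f (ract n r) m = f n (r *: m) }.

(* tens : N -> M -> T, (n, m) |-> n (x) m, exhibits the abelian group T as the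
   tensor product of the right R-module N and the left R-module M. *)
Record is_tensor_product (R : pzRingType) (N : zmodType) (ract : N -> R -> N)
    (M : lmodType R) (T : zmodType) (tens : N -> M -> T) : Prop := {
  tens_balanced : is_balanced ract tens;
  tens_universal : forall (B : zmodType) (f : N -> M -> B),
    is_balanced ract f ->
    exists g : {additive T -> B},
      (forall n m, g (tens n m) = f n m) /\
      (forall g' : {additive T -> B},
        (forall n m, g' (tens n m) = f n m) -> g' =1 g) }.

(* MS is Q (x)_R M, where Q is a right R-module through iota, with its usual
   left Q-module structure q' (q (x) m) = (q' q) (x) m. *)
Record is_extension_of_scalars (R Q : pzRingType) (iota : {rmorphism R -> Q})
    (M : lmodType R) (MS : lmodType Q) (tens : Q -> M -> MS) : Prop := {
  ext_tensor : is_tensor_product (fun (q : Q) (r : R) => q * iota r) tens;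
  ext_scale : forall (q' q : Q) (m : M), q' *: tens q m = tens (q' * q) m }.

(* The Q-R-bimodule structure on Q (x)_R M coming from the R-R-bimodule M:
   (q (x) m) r = q (x) (m r). *)
Record is_tensor_bimodule (R Q : pzRingType)
    (M : lmodType R) (ract : M -> R -> M)
    (MS : lmodType Q) (tens : Q -> M -> MS) (ractMS : MS -> R -> MS) :
    Prop := {
  tbim_bimodule : is_bimodule ractMS;
  tbim_tens : forall (q : Q) (m : M) (r : R),
    ractMS (tens q m) r = tens q (ract m r) }.

Record extends_bimodule (R Q : pzRingType) (iota : {rmorphism R -> Q})
    (MS : lmodType Q) (ractMS : MS -> R -> MS) (ractQ : MS -> Q -> MS) :
    Prop := {
  extb_bimodule : is_bimodule ractQ;
  extb_restrict : forall (x : MS) (r : R), ractQ x (iota r) = ractMS x r }.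

Record is_fodc (R : pzRingType) (Omega : lmodType R)
    (ract : Omega -> R -> Omega) (d : R -> Omega) : Prop := {
  fodc_bimodule : is_bimodule ract;
  fodc_add : forall a b : R, d (a + b) = d a + d b;
  fodc_leibniz : forall a b : R, d (a * b) = ract (d a) b + a *: d b;
  fodc_generated : forall x : Omega, exists s : seq (R * R),
    x = \sum_(p <- s) p.1 *: d p.2 }.

Record is_fodc_morphism
    (R : pzRingType) (Omega : lmodType R)
    (ract : Omega -> R -> Omega) (d : R -> Omega)
    (R' : pzRingType) (Omega' : lmodType R')
    (ract' : Omega' -> R' -> Omega') (d' : R' -> Omega')
    (f : {rmorphism R -> R'}) (e : Omega -> Omega') : Prop := {
  fmor_add : forall x y : Omega, e (x + y) = e x + e y;
  fmor_left : forall (a : R) (x : Omega), e (a *: x) = f a *: e x;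
  fmor_right : forall (x : Omega) (b : R), e (ract x b) = ract' (e x) (f b);
  fmor_d : forall r : R, e (d r) = d' (f r) }.

(* Main.v *)
Require Import Defs.
From HB Require Import structures.
From mathcomp Require Import all_boot all_order all_algebra.
From mathcomp Require Import boolp classical_sets.
From mathcomp Require Import functions ring_quotient.

Set Implicit Arguments.
Unset Strict Implicit.
Unset Printing Implicit Defensive.

Import GRing.Theory.
Local Open Scope classical_set_scope.
Local Open Scope ring_scope.

(* (i) => (ii): write (1 (x) dr) t^-1 = s^-1 (1 (x) w) and clear denominators;
   only the extension of the bimodule structure is needed, not d_S.
   (ii) => (i): each t in S acts bijectively on the right of S^-1 Omega, being
   injective by torsion-freeness and surjective because s dr = w t gives
   q (x) dr = (q s^-1 (x) w) t. A right R-module on which S acts bijectively is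
   uniquely a right S^-1 R-module. Applied to S^-1 Omega this yields the
   bimodule, and applied to S^-1 R (+) S^-1 Omega, with R acting by
   (q, x) r = (q r, q (1 (x) dr) + x r), it yields d_S. *)

(** The tensor product is known only through maps out of it, so a subgroup is studied through its
    quotient, which can serve as the target of balanced maps. *)
Lemma subgroup_quotient (V : zmodType) (P : set V) :
    P 0 -> (forall x y, P x -> P y -> P (x - y)) ->
  exists (W : zmodType) (pi : {additive V -> W}), forall x, pi x = 0 <-> P x.
Proof.
move=> P0 PB; pose I x := `[< P x >].
have clI : zmod_closed (I : pred V).
  split; first exact/asboolP.
  by move=> x y /asboolP Px /asboolP Py; apply/asboolP; apply: PB.
pose mixI := GRing.isZmodClosed.Build V I clI.
pose J : zmodClosed V := HB.pack I mixI.
exists (Quotient.quot J), (\pi_(Quotient.quot J)%qT) => x /=.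
have := Quotient.idealrBE J x 0; rewrite subr0 => xJ.
split=> [x0|Px].
  by apply/asboolP; change (x \in J); rewrite xJ x0 [X in _ == X]raddf0.
have : x \in J by apply/asboolP.
by rewrite xJ => /eqP ->; rewrite raddf0.
Qed.

(** * Additivity of right actions *)

Section RightActions.

Variables (B : pzRingType) (M : zmodType) (ract : M -> B -> M).
Hypothesis ractP : is_right_action ract.

Lemma ract0l b : ract 0 b = 0.
Proof. by apply: (addrI (ract 0 b)); rewrite -(ract_addl ractP) !addr0. Qed.

Lemma ractNl x b : ract (- x) b = - ract x b.
Proof.
by apply: (addrI (ract x b)); rewrite -(ract_addl ractP) !subrr ract0l.
Qed.

Lemma ractBl x y b : ract (x - y) b = ract x b - ract y b.
Proof. by rewrite (ract_addl ractP) ractNl. Qed.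

Lemma ract_suml (I : Type) (s : seq I) (F : I -> M) b :
  ract (\sum_(i <- s) F i) b = \sum_(i <- s) ract (F i) b.
Proof.
elim: s => [|i s IHs]; first by rewrite !big_nil ract0l.
by rewrite !big_cons (ract_addl ractP) IHs.
Qed.

End RightActions.

(** * Left fractions: numerators and common denominators *)

Section OreLocalization.

Variables (R : pzRingType) (S : set R) (oreS : is_left_ore_set S).
Variables (Q : pzRingType) (iota : {rmorphism R -> Q}).
Hypothesis fracQ : is_left_fraction_ring S iota.

Lemma exists_numerator (q : Q) :
  exists s r, S s /\ iota s * q = iota r.
Proof.
have [s [r [u [Ss us su ->]]]] := frac_form fracQ q.
by exists s, r; rewrite mulrA su mul1r.
Qed.

Lemma exists_common_denominator (p q : Q) :
  exists s a b, [/\ S s, iota s * p = iota a & iota s * q = iota b].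
Proof.
have [s1 [a [S1 pa]]] := exists_numerator p.
have [s2 [b [S2 qb]]] := exists_numerator q.
have [s' [c [S' cs]]] := ore_left oreS s1 S2.
exists (s' * s1), (s' * a), (c * b); split; first exact: ore_mul.
- by rewrite !rmorphM -mulrA pa.
- by rewrite -cs !rmorphM -mulrA qb.
Qed.

Lemma iota_eq a b : iota a = iota b -> exists s, S s /\ s * a = s * b.
Proof.
move=> ab; have /(frac_ker fracQ)[s [Ss s0]] : iota (a - b) = 0.
  by rewrite rmorphB ab subrr.
by exists s; split=> //; apply/eqP; rewrite -subr_eq0 -mulrBr s0.
Qed.

Lemma iota_scale_inj (N : lmodType Q) s : S s ->
  injective (fun x : N => iota s *: x).
Proof.
move=> Ss x y /(congr1 ( *:%R _)); have [u [us _]] := frac_inv fracQ Ss.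
by move/(_ u); rewrite !scalerA us !scale1r.
Qed.

(** Writing [x] as [(x s^-1) s] turns [x q] into [(x s^-1) r], where [r = s q] comes from [R] and
    linearity over [R] applies. *)
Lemma ractQ_hom (M N : zmodType) (ractM : M -> Q -> M) (ractN : N -> Q -> N)
    (f : M -> N) : is_right_action ractM -> is_right_action ractN ->
    (forall x r, f (ractM x (iota r)) = ractN (f x) (iota r)) ->
  forall x q, f (ractM x q) = ractN (f x) q.
Proof.
move=> actM actN f_iota x q.
have [s [r [Ss sq]]] := exists_numerator q.
have [u [us _]] := frac_inv fracQ Ss.
have -> : x = ractM (ractM x u) (iota s) by rewrite -ract_mul // us ract_one.
by rewrite -ract_mul // sq !f_iota -sq ract_mul.
Qed.

(** * Extension of a right action to the ring of fractions *)

Section ActionExtension.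

Variables (N : lmodType Q) (rho : N -> R -> N).
Hypothesis bimN : is_bimodule rho.
Hypothesis rho_inj : forall s, S s -> injective (rho^~ s).
Hypothesis rho_surj : forall s x, S s -> exists y, rho y s = x.

Let actN := bimod_right bimN.

(** Makes [x q := y r] well defined, for [q = s^-1 r] and [x = y s]. Two presentations are compared
    over a common left multiple [t s' s1 = t c s2]. As [c] need not lie in [S], it is [y1] that is
    divided, by [t s']; cancelling [s2] then gives [y2 = y (t c)]. *)
Lemma fraction_act_unique (q : Q) s1 r1 s2 r2 y1 y2 :
    S s1 -> iota s1 * q = iota r1 -> S s2 -> iota s2 * q = iota r2 ->
  rho y1 s1 = rho y2 s2 -> rho y1 r1 = rho y2 r2.
Proof.
move=> S1 q1 S2 q2 y12.
have [s' [c [S' cs]]] := ore_left oreS s1 S2.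
have /iota_eq [t [St tr]] : iota (s' * r1) = iota (c * r2).
  by rewrite !rmorphM -q1 -q2 !mulrA -!rmorphM cs.
have [y yE] := rho_surj y1 (ore_mul oreS St S').
have y2E : y2 = rho y (t * c).
  apply: (rho_inj S2); rewrite /= -y12 -yE -!(ract_mul actN).
  by rewrite -!mulrA cs.
by rewrite -yE y2E -!(ract_mul actN) -!mulrA tr.
Qed.

Lemma fraction_act_exists (x : N) (q : Q) :
  exists z, exists s r y, [/\ S s, iota s * q = iota r, rho y s = x &
    z = rho y r].
Proof.
have [s [r [Ss sq]]] := exists_numerator q.
by have [y yx] := rho_surj x Ss; exists (rho y r), s, r, y.
Qed.

Lemma bimodule_extension : exists ractQ, extends_bimodule iota rho ractQ.
Proof.
pose act x q := projT1 (cid (fraction_act_exists x q)).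
(* The choice made in [act] is immaterial, so each axiom below may use the presentation that suits
   it. *)
have actE x q s r y : S s -> iota s * q = iota r -> rho y s = x ->
    act x q = rho y r.
  rewrite /act; case: cid => z /= [s1 [r1 [y1 [S1 q1 yx1 ->]]]] Ss sq yx.
  by apply: (fraction_act_unique S1 q1 Ss sq); rewrite yx1 yx.
have act_iota x r : act x (iota r) = rho x r.
  apply: (actE _ _ 1); first exact: ore_one oreS.
    by rewrite rmorph1 mul1r.
  exact: ract_one actN _.
exists act; split=> //; split; first split.
- by move=> x; rewrite -(rmorph1 iota) act_iota (ract_one actN).
- move=> x a b; have [s1 [r1 [S1 q1]]] := exists_numerator a.
  have [s2 [r2 [S2 q2]]] := exists_numerator b.
  (* From [c s2 = s' r1] one gets [a b = (s' s1)^-1 (c r2)]; with [x = y s' s1], both sides become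
     [y c r2]. *)
  have [s' [c [S' cs]]] := ore_left oreS r1 S2.
  have [y yx] := rho_surj x (ore_mul oreS S' S1).
  rewrite (actE x a (s' * s1) (s' * r1) y) //; last 2 first.
  + exact: ore_mul oreS _ _ S' S1.
  + by rewrite !rmorphM -mulrA q1.
  rewrite (actE _ b s2 r2 (rho y c)) -?(ract_mul actN) ?cs //.
  apply: (actE _ _ (s' * s1)) => //; first exact: ore_mul oreS _ _ S' S1.
  rewrite !rmorphM -q2 [LHS]mulrA -[_ * a]mulrA q1.
  by rewrite [RHS]mulrA -!rmorphM cs.
- move=> x y b; have [s [r [Ss sb]]] := exists_numerator b.
  have [x' xE] := rho_surj x Ss; have [y' yE] := rho_surj y Ss.
  rewrite (actE x b s r x') // (actE y b s r y') // -(ract_addl actN).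
  by apply: (actE _ _ s); rewrite // (ract_addl actN) xE yE.
- move=> x a b; have [s [a' [b' [Ss sa sb]]]] := exists_common_denominator a b.
  have [y yx] := rho_surj x Ss.
  rewrite (actE x a s a' y) // (actE x b s b' y) // -(ract_addr actN).
  by apply: (actE _ _ s); rewrite // mulrDr sa sb rmorphD.
- move=> a x b; have [s [r [Ss sb]]] := exists_numerator b.
  have [y yx] := rho_surj x Ss.
  rewrite (actE x b s r y) // -(bimod_comm bimN).
  by apply: (actE _ _ s); rewrite // (bimod_comm bimN) yx.
Qed.

End ActionExtension.

(** * Localized modules: fractions and the kernel of localization *)

Section ExtensionOfScalars.

Variables (M : lmodType R) (MS : lmodType Q) (tens : Q -> M -> MS).
Hypothesis extMS : is_extension_of_scalars iota tens.

Let balT := tens_balanced (ext_tensor extMS).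

Lemma tensDl p q m : tens (p + q) m = tens p m + tens q m.
Proof. exact: bal_addl balT _ _ _. Qed.

Lemma tensDr q m n : tens q (m + n) = tens q m + tens q n.
Proof. exact: bal_addr balT _ _ _. Qed.

Lemma tensBr q m n : tens q (m - n) = tens q m - tens q n.
Proof.
by apply: (addIr (tens q n)); rewrite -tensDr !subrK.
Qed.

Lemma tens0r q : tens q 0 = 0.
Proof. by apply: (addrI (tens q 0)); rewrite -tensDr !addr0. Qed.

Lemma tens_sumr (I : Type) (s : seq I) (F : I -> M) q :
  tens q (\sum_(i <- s) F i) = \sum_(i <- s) tens q (F i).
Proof.
elim: s => [|i s IHs]; first by rewrite !big_nil tens0r.
by rewrite !big_cons tensDr IHs.
Qed.

Lemma tensZr q r m : tens q (r *: m) = tens (q * iota r) m.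
Proof. by rewrite (bal_mid balT). Qed.

Lemma tens1Z r m : tens 1 (r *: m) = iota r *: tens 1 m.
Proof. by rewrite tensZr (ext_scale extMS) mul1r mulr1. Qed.

Lemma scale_tens1 q m : q *: tens 1 m = tens q m.
Proof. by rewrite (ext_scale extMS) mulr1. Qed.

(** The elements with a denominator form a subgroup containing all pure tensors. The projection
    modulo it and the zero map agree on these, so they coincide by uniqueness in the universal
    property. *)
Lemma ext_num (x : MS) : exists s m, S s /\ iota s *: x = tens 1 m.
Proof.
pose P (y : MS) := exists s m, S s /\ iota s *: y = tens 1 m.
have P0 : P 0.
  by exists 1, 0; split; [exact: ore_one oreS | rewrite scaler0 tens0r].
have PB y z : P y -> P z -> P (y - z).
  move=> [s1 [m1 [S1 y1]]] [s2 [m2 [S2 z2]]].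
  have [s' [c [S' cs]]] := ore_left oreS s1 S2.
  exists (s' * s1), (s' *: m1 - c *: m2); split; first exact: ore_mul.
  rewrite scalerBr tensBr !tens1Z -y1 -z2 !scalerA -!rmorphM.
  by rewrite cs.
have [W [pi piP]] := subgroup_quotient P0 PB.
have bal0 : is_balanced (fun (q : Q) (r : R) => q * iota r)
    (fun (_ : Q) (_ : M) => 0 : W).
  by split=> *; rewrite ?addr0.
have [g [_ g_uniq]] := tens_universal (ext_tensor extMS) bal0.
apply/piP; rewrite g_uniq => [|q m].
  by rewrite -(g_uniq (\0 : {additive MS -> W})).
apply/piP; have [s [r [Ss sq]]] := exists_numerator q.
exists s, (r *: m); split=> //.
by rewrite (ext_scale extMS) sq tensZr mul1r.
Qed.

Lemma ext_fracP (x : MS) : exists q m, x = tens q m.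
Proof.
have [s [m [Ss sx]]] := ext_num x; have [u [us _]] := frac_inv fracQ Ss.
by exists u, m; rewrite -scale_tens1 -sx scalerA us scale1r.
Qed.

(** Torsion for the left action, which is the kernel of [tens 1]; the hypothesis of the theorem
    concerns torsion for the right action. *)
Definition ore_torsion (m : M) := exists s, S s /\ s *: m = 0.

Lemma ore_torsion0 : ore_torsion 0.
Proof. by exists 1; rewrite scaler0; split=> //; exact: ore_one oreS. Qed.

Lemma ore_torsionB m n : ore_torsion m -> ore_torsion n -> ore_torsion (m - n).
Proof.
move=> [s1 [S1 m0]] [s2 [S2 n0]].
have [s' [c [S' cs]]] := ore_left oreS s1 S2.
exists (s' * s1); split; first exact: ore_mul.
by rewrite scalerBr -{2}cs -!scalerA m0 n0 !scaler0 subr0.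
Qed.

Lemma ore_torsion_iota a b m : iota a = iota b -> ore_torsion (a *: m - b *: m).
Proof.
move=> /iota_eq [s [Ss sab]]; exists s; split=> //.
by rewrite scalerBr !scalerA sab subrr.
Qed.

(* Instead of constructing the module of fractions, detect nonzero elements by
   the balanced map sending (q, m) to the germ of r |-> (r q) m, defined where
   r q lies in the image of R. Germs are functions R -> M modulo those that are
   torsion-valued on some left ideal R s with s in S. *)
Lemma tens1_eq0 m : tens 1 m = 0 -> ore_torsion m.
Proof.
move=> m0.
pose H (phi : R -> M) := exists s, S s /\ forall c, ore_torsion (phi (c * s)).
have H0 : H 0.
  by exists 1; split=> [|c]; [exact: ore_one oreS | exact: ore_torsion0].
have HB phi psi : H phi -> H psi -> H (phi - psi).
  move=> [s1 [S1 t1]] [s2 [S2 t2]].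
  have [s' [c' [S' cs]]] := ore_left oreS s1 S2.
  exists (s' * s1); split=> [|c]; first exact: ore_mul.
  apply: ore_torsionB; first by rewrite mulrA; exact: t1.
  by rewrite -cs mulrA; exact: t2.
have [W [pi piP]] := subgroup_quotient H0 HB.
(* The default 0 is harmless: germs are compared on multiples of a denominator of [q], where a
   numerator of [r q] exists. Two numerators have the same image in [Q], so their actions differ by
   torsion. *)
pose num (q : Q) (r : R) := xget 0 [set a | iota a = iota r * q].
have numP q r a : iota a = iota r * q -> iota (num q r) = iota r * q.
  by move=> ar; apply: (@xgetPex _ 0 [set a | iota a = iota r * q]); exists a.
pose f (q : Q) (n : M) : W := pi (fun r => num q r *: n).
have f_eq (phi psi : R -> M) : H (phi - psi) -> pi phi = pi psi.
  by move=> /piP /eqP; rewrite raddfB subr_eq0 => /eqP.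
have balf : is_balanced (fun (q : Q) (r : R) => q * iota r) f.
  split.
  - move=> p q n; rewrite /f -raddfD; apply: f_eq.
    have [s [a [b [Ss sp sq]]]] := exists_common_denominator p q.
    exists s; split=> // c.
    change (ore_torsion
      (num (p + q) (c * s) *: n - (num p (c * s) *: n + num q (c * s) *: n))).
    rewrite -scalerDl; apply: ore_torsion_iota.
    rewrite rmorphD (@numP p _ (c * a)); last by rewrite !rmorphM -mulrA sp.
    rewrite (@numP q _ (c * b)); last by rewrite !rmorphM -mulrA sq.
    rewrite (@numP (p + q) _ (c * (a + b))) ?mulrDr //.
    by rewrite rmorphD !rmorphM -!mulrA sp sq.
  - move=> q n n'; rewrite /f -raddfD; congr (pi _).
    by apply/funext => r; rewrite scalerDr.
  - move=> q r n; apply: f_eq.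
    have [s [a [Ss sq]]] := exists_numerator q.
    exists s; split=> // c.
    change (ore_torsion
      (num (q * iota r) (c * s) *: n - num q (c * s) *: (r *: n))).
    rewrite scalerA; apply: ore_torsion_iota.
    rewrite rmorphM (@numP q _ (c * a)); last by rewrite !rmorphM -mulrA sq.
    rewrite (@numP _ _ (c * a * r)) ?mulrA //.
    by rewrite !rmorphM -[_ * q]mulrA sq.
have [g [gE _]] := tens_universal (ext_tensor extMS) balf.
have /piP [s [Ss ts]] : f 1 m = 0 by rewrite -gE m0 raddf0.
(* The vanishing germ is evaluated at [c = 1]: there [num 1 s] acts as [s] up to torsion, so [s m]
   is torsion, and hence [m]. *)
have numE : iota (num 1 (1 * s)) = iota s.
  by rewrite (@numP _ _ s) ?mul1r mulr1.
have [s' [S' s0]] : ore_torsion (s *: m).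
  rewrite -(subKr (num 1 (1 * s) *: m) (s *: m)).
  by apply: ore_torsionB; [exact: ts | exact: ore_torsion_iota].
by exists (s' * s); split; [exact: ore_mul | rewrite -scalerA].
Qed.

Lemma tens1_eq m n : tens 1 m = tens 1 n -> exists s, S s /\ s *: m = s *: n.
Proof.
move=> mn; have [|s [Ss s0]] := @tens1_eq0 (m - n).
  by rewrite tensBr mn subrr.
by exists s; split=> //; apply/eqP; rewrite -subr_eq0 -scalerBr s0.
Qed.

End ExtensionOfScalars.

End OreLocalization.

(** * The calculus induced on the localization *)

Section InducedCalculus.

Variables (R : pzRingType) (Omega : lmodType R) (ract : Omega -> R -> Omega).
Variables (d : R -> Omega) (fodc_d : is_fodc ract d).
Variables (S : set R) (oreS : is_left_ore_set S).
Variables (Q : pzRingType) (iota : {rmorphism R -> Q}).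
Hypothesis fracQ : is_left_fraction_ring S iota.
Variables (OmegaS : lmodType Q) (tens : Q -> Omega -> OmegaS).
Hypothesis extOmegaS : is_extension_of_scalars iota tens.
Variable ractS : OmegaS -> R -> OmegaS.
Hypothesis bimOmegaS : is_tensor_bimodule ract tens ractS.

Let bimS := tbim_bimodule bimOmegaS.
Let actS := bimod_right bimS.
Let ract_tens := tbim_tens bimOmegaS.

Lemma tens1_d_mul a b :
  tens 1 (d (a * b)) = ractS (tens 1 (d a)) b + iota a *: tens 1 (d b).
Proof.
by rewrite (fodc_leibniz fodc_d) (tensDr extOmegaS) (tens1Z extOmegaS) ract_tens.
Qed.

(** Let [m] be a numerator of [x]. If [x t = 0], then [m t] is left torsion, and
    [s' (m t) = (s' m) t] turns this into right torsion of [s' m]. *)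
Lemma ractS_inj t : S t ->
  (forall x, ract x t = 0 -> x = 0) -> injective (ractS^~ t).
Proof.
move=> St tf; have ker x : ractS x t = 0 -> x = 0.
  have [s [m [Ss sx]]] := ext_num oreS fracQ extOmegaS x => x0.
  have : tens 1 (ract m t) = 0.
    by rewrite -ract_tens -sx (bimod_comm bimS) x0 scaler0.
  move=> /(tens1_eq0 oreS fracQ extOmegaS) [s' [S' s0]].
  have {s0}m0 : s' *: m = 0.
    by apply: tf; rewrite (bimod_comm (fodc_bimodule fodc_d)).
  apply: (iota_scale_inj fracQ (ore_mul oreS S' Ss)) => /=.
  rewrite rmorphM -scalerA sx -(tens1Z extOmegaS) m0 scaler0.
  exact: (tens0r extOmegaS).
move=> x y /= xy; apply/eqP; rewrite -subr_eq0; apply/eqP; apply: ker.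
by rewrite (ractBl actS) xy subrr.
Qed.

Lemma ractS_surj t : S t ->
    (forall r, exists s omega, S s /\ s *: d r = ract omega t) ->
  forall x, exists y, ractS y t = x.
Proof.
move=> St dOre x; have [q [m ->]] := ext_fracP oreS fracQ extOmegaS x.
have [s ->] := fodc_generated fodc_d m; rewrite (tens_sumr extOmegaS).
elim: s => [|[a r] s [y yE]]; first by exists 0; rewrite big_nil (ract0l actS).
have [s' [w [S' sw]]] := dOre r; have [u [us _]] := frac_inv fracQ S'.
exists (tens (q * iota a * u) w + y); rewrite big_cons (ract_addl actS) yE.
congr (_ + _); rewrite ract_tens -sw (tensZr extOmegaS) /=.
by rewrite -mulrA us mulr1 (tensZr extOmegaS).
Qed.

(** Row vectors [(q, x)] times the matrix with rows [(r, dr)] and [(0, r)]; the Leibniz rule says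
    that these matrices multiply as elements of [R] do. [Q^o] is [Q] as a left module over
    itself. *)
Let twist (x : Q^o * OmegaS) (r : R) : Q^o * OmegaS :=
  ((x.1 : Q) * iota r, (x.1 : Q) *: tens 1 (d r) + ractS x.2 r).

Lemma twist_bimodule : is_bimodule twist.
Proof.
split; first split.
- move=> [q x]; rewrite /twist /= rmorph1 mulr1 (ract_one actS).
  have -> : tens 1 (d 1) = 0; last by rewrite scaler0 add0r.
  have := tens1_d_mul 1 1; rewrite mulr1 (ract_one actS) rmorph1 scale1r.
  by move=> d1; apply: (addrI (tens 1 (d 1))); rewrite addr0.
- move=> [q x] a b; rewrite /twist /= rmorphM mulrA; congr pair.
  rewrite tens1_d_mul scalerDr scalerA (ract_mul actS) (ract_addl actS).
  by rewrite (bimod_comm bimS) addrA [X in X + _ = _]addrC.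
- move=> [p x] [q y] b; rewrite /twist /= mulrDl scalerDl (ract_addl actS).
  by rewrite addrACA.
- move=> [q x] a b; rewrite /twist /= rmorphD mulrDr (fodc_add fodc_d).
  rewrite (tensDr extOmegaS) scalerDr (ract_addr actS).
  by congr pair; rewrite /= addrACA.
- move=> a [q x] b; rewrite /twist /= -[a *: q]/(a * q).
  rewrite (bimod_comm bimS) -scalerA -scalerDr; congr pair.
  by rewrite -mulrA.
Qed.

Lemma twist_inj t : S t -> injective (ractS^~ t) -> injective (twist^~ t).
Proof.
move=> St injt [p x] [q y] [pq xy].
have [u [_ tu]] := frac_inv fracQ St.
have {pq}E : p = q.
  by rewrite -[p]mulr1 -[q]mulr1 -tu !mulrA pq.
by congr pair => //; apply: injt; move: xy; rewrite E => /addrI.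
Qed.

Lemma twist_surj t : S t -> (forall x, exists y, ractS y t = x) ->
  forall x, exists y, twist y t = x.
Proof.
move=> St surjt [q x]; have [u [ut _]] := frac_inv fracQ St.
(* The twisted action is triangular: the first coordinate must be [q t^-1], which leaves
   [y t = x - q t^-1 dt] to solve. *)
have [y yE] := surjt (x - ((q : Q) * u) *: tens 1 (d t)).
exists (q * u, y); rewrite /twist /= yE -mulrA ut mulr1; congr pair.
by rewrite addrC subrK.
Qed.

Lemma induced_fodc :
    (forall s, S s -> injective (ractS^~ s)) ->
    (forall s x, S s -> exists y, ractS y s = x) ->
  exists ractQ, extends_bimodule iota ractS ractQ /\
    exists dS, is_fodc ractQ dS /\
      is_fodc_morphism ract d ractQ dS iota (tens 1).
Proof.
move=> injS surjS.
have [ractQ extQ] := bimodule_extension oreS fracQ bimS injS surjS.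
have [bimQ resQ] := extQ; have actQ := bimod_right bimQ.
have injT s : S s -> injective (twist^~ s).
  by move=> Ss; apply: twist_inj => //; exact: injS.
have surjT s x : S s -> exists y, twist y s = x.
  by move=> Ss; apply: twist_surj => // y; exact: surjS.
have [T [bimT resT]] :=
  bimodule_extension oreS fracQ twist_bimodule injT surjT.
have actT := bimod_right bimT.
(* The inclusion of [OmegaS] and the projection to [Q] are linear over [R], hence over [Q] by
   [ractQ_hom]; thus [T] is triangular as well. *)
have T1 x q : (T x q).1 = x.1 * q.
  have actQQ : is_right_action (fun p q : Q => p * q).
    by split=> *; rewrite ?mulr1 ?mulrA ?mulrDl ?mulrDr.
  apply: (ractQ_hom fracQ actT actQQ (f := fst)) => {}x r.
  by rewrite resT.
have T2 x q : T (0, x) q = (0, ractQ x q).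
  symmetry; apply: (ractQ_hom fracQ actQ actT (f := fun x => (0, x))).
  by move=> y r; rewrite resT resQ /twist /= mul0r scale0r add0r.
(* The Leibniz rule for dS is the associativity of T. *)
pose dS q := (T (1, 0) q).2.
have TE q : T (1, 0) q = (q, dS q).
  by rewrite [LHS]surjective_pairing T1 mul1r.
have dS_iota r : dS (iota r) = tens 1 (d r).
  by rewrite /dS resT /twist /= scale1r (ract0l actS) addr0.
exists ractQ; split=> //; exists dS; split; split.
- exact: bimQ.
- by move=> a b; rewrite /dS (ract_addr actT).
- move=> a b; rewrite {1}/dS (ract_mul actT) TE.
  (* On the second summand [T] commutes with the left scalar [a], so the second components give
     [dS a] times [b] plus [a] times [dS b]. *)
  have -> : (a, dS a) =
      ((0, dS a) : Q^o * OmegaS) + a *: ((1, 0) : Q^o * OmegaS).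
    by congr pair => /=; rewrite ?add0r ?scaler0 ?addr0 -?[a *: _]/(a * 1) ?mulr1.
  by rewrite (ract_addl actT) T2 (bimod_comm bimT) TE.
- move=> x; have [q [m ->]] := ext_fracP oreS fracQ extOmegaS x.
  have [s ->] := fodc_generated fodc_d m.
  exists [seq (q * iota p.1, iota p.2) | p <- s].
  rewrite (tens_sumr extOmegaS) big_map; apply: eq_bigr => p _ /=.
  by rewrite dS_iota (scale_tens1 extOmegaS) (tensZr extOmegaS).
- exact: tensDr extOmegaS _.
- exact: tens1Z extOmegaS.
- by move=> x b; rewrite resQ ract_tens.
- by move=> r; rewrite dS_iota.
Qed.

Lemma differential_ore_of_extension ractQ :
    extends_bimodule iota ractS ractQ ->
  forall t x, S t -> exists s omega, S s /\ s *: x = ract omega t.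
Proof.
move=> [bimQ resQ] t x St; have actQ := bimod_right bimQ.
have [u [ut _]] := frac_inv fracQ St.
have [s [w [Ss sw]]] := ext_num oreS fracQ extOmegaS (ractQ (tens 1 x) u).
have : tens 1 (s *: x) = tens 1 (ract w t).
  rewrite -ract_tens -sw (bimod_comm bimS) -resQ -(ract_mul actQ) ut.
  by rewrite (ract_one actQ) (tens1Z extOmegaS).
(* Equality after localization lifts to [Omega] only up to a left factor [s'], which both witnesses
   absorb. *)
move=> /(tens1_eq oreS fracQ extOmegaS) [s' [S' E]].
exists (s' * s), (s' *: w); split; first exact: ore_mul.
by rewrite -scalerA E (bimod_comm (fodc_bimodule fodc_d)).
Qed.

End InducedCalculus.

Theorem mainTheorem2
  (R : pzRingType)
  (Omega : lmodType R) (ract : Omega -> R -> Omega) (d : R -> Omega)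
  (fodc_d : is_fodc ract d)
  (S : set R) (oreS : is_left_ore_set S)
  (RS : pzRingType) (iota : {rmorphism R -> RS})
  (fracRS : is_left_fraction_ring S iota)
  (OmegaS : lmodType RS) (tens : RS -> Omega -> OmegaS)
  (extOmegaS : is_extension_of_scalars iota tens)
  (ractS : OmegaS -> R -> OmegaS)
  (bimOmegaS : is_tensor_bimodule ract tens ractS)
  (torsion_free :
    [set x : Omega | exists t : R, S t /\ ract x t = 0] = [set 0]) :
  ((exists ractRS : OmegaS -> RS -> OmegaS,
      extends_bimodule iota ractS ractRS /\
      exists dS : RS -> OmegaS,
        is_fodc ractRS dS /\
        is_fodc_morphism ract d ractRS dS iota (fun x : Omega => tens 1 x))
   <->
   (forall t r : R, S t ->
      exists (s : R) (omega : Omega), S s /\ s *: d r = ract omega t))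
  /\
  (forall ract1 ract2 : OmegaS -> RS -> OmegaS,
      extends_bimodule iota ractS ract1 ->
      extends_bimodule iota ractS ract2 ->
      forall (x : OmegaS) (q : RS), ract1 x q = ract2 x q).
Proof.
split; first split.
- move=> [ractQ [extQ _]] t r St.
  exact: (differential_ore_of_extension fodc_d oreS fracRS extOmegaS bimOmegaS
    extQ).
- move=> dOre; apply: (induced_fodc fodc_d oreS fracRS extOmegaS bimOmegaS).
  + move=> s Ss; apply: (ractS_inj fodc_d oreS fracRS extOmegaS bimOmegaS) => //.
    move=> x x0; change ([set 0] x); rewrite -torsion_free.
    by exists s.
  + move=> s x Ss.
    apply: (ractS_surj fodc_d oreS fracRS extOmegaS bimOmegaS) => // r.
    exact: dOre.
- move=> ract1 ract2 [bim1 res1] [bim2 res2].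
  (* Uniqueness: the identity map between the two structures is linear over [R], hence over [RS]. *)
  apply: (ractQ_hom fracRS (bimod_right bim1) (bimod_right bim2) (f := id)).
  by move=> x r; rewrite res1 res2.
Qed.
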